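(* Let $n\ge 1$, and let $(N,M)$ and $(\hat N,\hat M)$ be two pairs of non-oriented distinct hyperspheres of $S^n$ (that is, $N\ne M$ and $\hat N\neq\hat M$), written as $$N=S(\mathfrak n),\quad M=S(\mathfrak m),\quad \hat N=S(\hat{\mathfrak n}),\quad \hat M=S(\hat{\mathfrak m}),\qquad \mathfrak n,\mathfrak m,\hat{\mathfrak n},\hat{\mathfrak m}\in H^{n+1}.$$ Then $(N,M)$ is $G_n$-equivalent to $(\hat N,\hat M)$ (i.e. there is $g\in G_n$ with $gN=\hat N$ and $gM=\hat M$) if and only if $$|\langle \mathfrak n,\mathfrak m\rangle|=|\langle\hat{\mathfrak n},\hat{\mathfrak m}\rangle|.$$
   Context: Let $V$ be a real vector space of dimension $n+2$ with a non-degenerate symmetric bilinear form $\langle\cdot,\cdot\rangle$ of index one (signature: $n+1$ plus signs, one minus sign). Let $\mathbb P$ be the projective space of one-dimensional subspaces of $V$. The Möbius space is $S^n=\{[x]\in\mathbb P : x\ne0,\ \langle x,x\rangle=0\}$. The Möbius group $G_n$ is the group of all projective transformations of $\mathbb P$ preserving $S^n$; it is $O(n+1,1)/\{1,-1\}$, where $O(n+1,1)$ is the group of linear isometries of $(V,\langle\cdot,\cdot\rangle)$. Let $H^{n+1}=\{\mathfrak n\in V:\langle\mathfrak n,\mathfrak n\rangle=1\}$. For $\mathfrak n\in H^{n+1}$ the hypersphere determined by $\mathfrak n$ is $S(\mathfrak n)=\{[x]\in S^n:\langle x,\mathfrak n\rangle=0\}$. The hyperspheres of $S^n$ are exactly the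 sets $S(\mathfrak n)$, and $S(\mathfrak n)=S(-\mathfrak n)$ as non-oriented hyperspheres. *)

(* Defs.v *)
From mathcomp Require Import all_boot all_order all_algebra.
From mathcomp Require Import sesquilinear.
From mathcomp Require Import boolp classical_sets reals.

Set Implicit Arguments.
Unset Strict Implicit.
Unset Printing Implicit Defensive.

Import Order.TTheory GRing.Theory Num.Theory.
Local Open Scope ring_scope.
Local Open Scope classical_set_scope.

Section Moebius.
Context {R : realType} {V : vectType R}.

Definition negative_definite_on (B : {symmetric V}) (U : {vspace V}) : Prop :=
  forall x, x \in U -> x != 0 -> B x x < 0.

(* Sylvester's negative index of inertia: the largest dimension of a subspace
   on which B is negative definite.  For nondegenerate B with \dim V = n.+2 and
   index 1, the signature has n.+1 plus signs and one minus sign. *)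
Definition has_index (B : {symmetric V}) (q : nat) : Prop :=
  (exists U : {vspace V}, \dim U = q /\ negative_definite_on B U) /\
  (forall U : {vspace V}, negative_definite_on B U -> (\dim U <= q)%N).

Definition proj : Type := {U : {vspace V} | \dim U == 1%N}.

(* The one-to-one function f : 'End(V) is a linear automorphism, as V is
   finite-dimensional. *)
Definition projective_transformation (g : proj -> proj) : Prop :=
  exists f : 'End(V),
    lker f = 0%VS /\ forall p : proj, val (g p) = (f @: val p)%VS.

Definition moebius_space (B : {symmetric V}) : set proj :=
  [set p | exists x : V, [/\ x != 0, B x x = 0 & val p = <[x]>%VS]].

Definition moebius_group (B : {symmetric V}) : set (proj -> proj) :=
  [set g | projective_transformation g /\
           g @` moebius_space B = moebius_space B].

(* The set H^(n+1) of the spacelike unit vectors. *)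
Definition unit_vectors (B : {symmetric V}) : set V := [set v | B v v = 1].

Definition hypersphere (B : {symmetric V}) (v : V) : set proj :=
  [set p | exists x : V,
     [/\ x != 0, B x x = 0, B x v = 0 & val p = <[x]>%VS]].

End Moebius.

Arguments proj {R} V.

(* Main.v *)
Require Import Defs.
From HB Require Import structures.
From mathcomp Require Import all_boot all_order all_algebra.
From mathcomp Require Import sesquilinear.
From mathcomp Require Import boolp classical_sets reals.
From mathcomp Require Import ring lra.

Set Implicit Arguments.
Unset Strict Implicit.
Unset Printing Implicit Defensive.

Import Order.TTheory GRing.Theory Num.Theory.
Local Open Scope ring_scope.
Local Open Scope classical_set_scope.

(** Scalar products of unit normals are conformal invariants up to sign, and
    conversely they determine the pair of hyperspheres by a theorem of Witt
    type.

    Necessity.  An element of the Moebius group is induced by a linear bijection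
    f that preserves the null cone of B.  In index one the null cone determines
    B up to a factor: take t with B t t < 0; then t^⊥ is positive definite, so
    each nonzero x in t^⊥ yields a null pair s t ± x, and evaluating B (f _) (f _)
    on both makes the pulled back form proportional to B.  Hence f is conformal:
    B (f x) (f y) = l * B x y ([null_preserving_conformal]).  For n >= 1 a
    hypersphere determines its unit normal up to sign, because its null vectors
    span the orthogonal complement of the normal ([null_orth_sub]).  Therefore
    f u = m u' and f v = k v'.  Taking squares, l = m^2 = k^2, and
    l B u v = m k B u' v' gives the claim in absolute value.

    Sufficiency.  Since v' and - v' give the same hypersphere, one may suppose
    B u v = B u' v'.  Two nonzero vectors with equal squares in a subspace on
    which B is nondegenerate are carried to each other by at most two
    reflections along vectors of that subspace ([witt_vector]), and these fix
    its orthogonal complement.  This is used first in the whole space to send u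
    to u', then in the complement of u'
    to match the components of the images of v and v' orthogonal to u'.  These
    components do not vanish because the hyperspheres are distinct; in the
    tangent case |B u v| = 1 they are null, which is why null vectors have to be
    moved too. *)

(** * Symmetric bilinear forms *)

Section SymmetricForms.
Context {R : realType} {V : vectType R} (B : {symmetric V}).
Implicit Types (a b t u v w x y z : V) (f : 'End(V)) (k : R).

Lemma sformZl k x y : B (k *: x) y = k * B x y.
Proof. exact: linearZl_LR. Qed.

Lemma sformZr k x y : B x (k *: y) = k * B x y.
Proof. exact: linearZr_LR. Qed.

Lemma sformC x y : B x y = B y x.
Proof. by rewrite hermC mul1r. Qed.

Lemma sformDl x y z : B (x + y) z = B x z + B y z.
Proof. exact: linearDl. Qed.

Lemma sformDr x y z : B x (y + z) = B x y + B x z.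
Proof. exact: linearDr. Qed.

Lemma sformNl x y : B (- x) y = - B x y.
Proof. exact: linearNl. Qed.

Lemma sformNr x y : B x (- y) = - B x y.
Proof. exact: linearNr. Qed.

Definition sformE := (sformDl, sformDr, sformNl, sformNr, sformZl, sformZr).

Lemma nondegenerateP x :
  nondegenerate B -> x != 0 -> exists z, B x z != 0.
Proof.
move=> /eqP ndB x0; apply: contrapT => /forallNP Bx0.
suff : x \in orthov B fullv by rewrite ndB memv0 (negPf x0).
by apply/mem_orthovP => z _; apply/eqP/negPn/negP/Bx0.
Qed.

Lemma nondegenerate0 x : nondegenerate B -> (forall z, B x z = 0) -> x = 0.
Proof.
move=> ndB Bx0; apply/eqP/negPn/negP => /(nondegenerateP ndB)[z].
by rewrite Bx0 eqxx.
Qed.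

Lemma isometry_ker f : nondegenerate B -> isometry B B f -> lker f = 0%VS.
Proof.
move=> ndB fB; apply/eqP; rewrite -subv0; apply/subvP => x.
rewrite memv_ker memv0 => /eqP fx0; apply/eqP/(nondegenerate0 ndB) => z.
by rewrite -fB fx0 linear0l.
Qed.

Lemma isometry_comp (f g : 'End(V)) :
  isometry B B f -> isometry B B g -> isometry B B (f \o g)%VF.
Proof. by move=> fB gB x y; rewrite !comp_lfunE fB gB. Qed.

(** * Reflections and Witt's theorem for vectors *)

Definition reflection a x := x - (2 * B x a / B a a) *: a.

Fact reflection_is_linear a : linear (reflection a).
Proof.
move=> k x y; rewrite /reflection !sformE scalerBr scalerA.
rewrite mulrDr mulrDl scalerDl opprD addrACA; congr (_ - _ *: _ + _).
by rewrite mulrCA !mulrA.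
Qed.

HB.instance Definition _ a :=
  GRing.isLinear.Build R V V _ (reflection a) (reflection_is_linear a).

Lemma reflection_isometry a : B a a != 0 -> isometry B B (linfun (reflection a)).
Proof.
move=> a0 x y; rewrite !lfunE /= /reflection !sformE (sformC a y).
by field.
Qed.

Lemma reflection_fix a x : B x a = 0 -> linfun (reflection a) x = x.
Proof.
by move=> xa0; rewrite lfunE /= /reflection xa0 mulr0 mul0r scale0r subr0.
Qed.

(** Equal squares make a + b orthogonal to a - b, so the reflection along
    a - b, which negates a - b and fixes a + b, exchanges a and b. *)
Lemma reflection_sub a b :
  B a a = B b b -> B (a - b) (a - b) != 0 -> linfun (reflection (a - b)) a = b.
Proof.
move=> aabb ab0; rewrite lfunE /= /reflection.
have -> : 2 * B a (a - b) = B (a - b) (a - b).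
  by rewrite !sformE (sformC b a) -aabb; ring.
by rewrite divff // scale1r opprB addrC subrK.
Qed.

Lemma reflection_opp a : B a a != 0 -> linfun (reflection a) (- a) = a.
Proof.
move=> a0; rewrite lfunE /= /reflection sformE mulrN mulNr mulfK //.
by rewrite scaleNr opprK scalerDl scale1r addKr.
Qed.

(** A vector space over an infinite field is not the union of two hyperplanes:
    if z1 and z2 serve only one of a and b each, their sum serves both. *)
Lemma common_nonorthogonal (W : {vspace V}) a b :
  (W :&: orthov B W = 0)%VS ->
  a \in W -> b \in W -> a != 0 -> b != 0 ->
  exists z, [/\ z \in W, B a z != 0 & B b z != 0].
Proof.
move=> ndW aW bW a0 b0.
have ex x : x \in W -> x != 0 -> exists2 z, z \in W & B x z != 0.
  move=> xW x0; apply: contrapT => nz.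
  suff : x \in (W :&: orthov B W)%VS by rewrite ndW memv0 (negPf x0).
  rewrite memv_cap xW; apply/mem_orthovP => z zW.
  by apply/eqP/negPn/negP => xz; apply: nz; exists z.
have [z1 z1W az1] := ex a aW a0; have [z2 z2W bz2] := ex b bW b0.
have [bz1|bz1] := eqVneq (B b z1) 0; last by exists z1.
have [az2|az2] := eqVneq (B a z2) 0; last by exists z2.
exists (z1 + z2); rewrite !sformE bz1 az2 addr0 add0r; split=> //.
exact: memvD.
Qed.

(** If a - b is not null, one reflection suffices.  If a - b is null but a is
    not, then a + b is not null, since the squares of a - b and a + b sum to
    4 B a a; reflect along a + b to reach - b, then along b.  If both are null,
    then B a b = 0, and one passes through a null vector e orthogonal to neither
    a nor b: a - e and e - b are then not null. *)
Lemma witt_vector (W : {vspace V}) a b :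
  (W :&: orthov B W = 0)%VS ->
  a \in W -> b \in W -> a != 0 -> b != 0 -> B a a = B b b ->
  exists f : 'End(V), [/\ isometry B B f, f a = b &
    forall x, x \in orthov B W -> f x = x].
Proof.
move=> ndW aW bW a0 b0 aabb.
have fix_orth c x : c \in W -> x \in orthov B W -> linfun (reflection c) x = x.
  by move=> cW /mem_orthovP xW; apply: reflection_fix; apply: xW.
have [ab0|ab0] := eqVneq (B (a - b) (a - b)) 0; last first.
  exists (linfun (reflection (a - b))); split.
  - exact: reflection_isometry.
  - exact: reflection_sub.
  - by move=> x; apply: fix_orth; exact: memvB.
have abE : B a b = B a a.
  by move: ab0; rewrite !sformE (sformC b a) -aabb; lra.
have [aa0|aa0] := eqVneq (B a a) 0; last first.
  have abp : B (a - - b) (a - - b) != 0.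
    rewrite opprK !sformE (sformC b a) -aabb abE.
    by apply: contra_neq aa0 => ?; lra.
  have bb0 : B b b != 0 by rewrite -aabb.
  exists (linfun (reflection b) \o linfun (reflection (a - - b)))%VF; split.
  - by apply: isometry_comp; apply: reflection_isometry.
  - rewrite comp_lfunE reflection_sub ?reflection_opp //.
    by rewrite !sformE opprK.
  - move=> x xW; rewrite comp_lfunE (fix_orth (a - - b)) ?fix_orth //.
    by rewrite opprK memvD.
have [z [zW az bz]] := common_nonorthogonal ndW aW bW a0 b0.
(* Correcting z by a multiple of a makes it null and keeps its products with
   a and b, because a is orthogonal to itself and to b. *)
have [e [eW ee0 ae be]] : exists e,
    [/\ e \in W, B e e = 0, B a e = B a z & B b e = B b z].
  exists (z - (B z z / (2 * B a z)) *: a).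
  rewrite memvB ?memvZ // !sformE (sformC z a) (sformC b a) abE aa0.
  by split=> //; field.
have ae0 : B (a - e) (a - e) != 0.
  rewrite !sformE (sformC e a) aa0 ee0 ae.
  by apply: contra_neq az => ?; lra.
have eb0 : B (e - b) (e - b) != 0.
  rewrite !sformE (sformC e b) -aabb aa0 ee0 be.
  by apply: contra_neq bz => ?; lra.
exists (linfun (reflection (e - b)) \o linfun (reflection (a - e)))%VF; split.
- by apply: isometry_comp; apply: reflection_isometry.
- by rewrite comp_lfunE !reflection_sub // ?ee0 ?aa0 // -aabb.
- by move=> x xW; rewrite comp_lfunE (fix_orth (a - e)) ?fix_orth ?memvB.
Qed.

Lemma orthov_unit_nondegenerate u : nondegenerate B -> B u u = 1 ->
  (orthov B <[u]> :&: orthov B (orthov B <[u]>) = 0)%VS.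
Proof.
move=> ndB uu; apply/eqP; rewrite -subv0; apply/subvP => x.
rewrite memv_cap memv0 => /andP[/mem_orthovP xu /mem_orthovP xW].
apply/eqP/(nondegenerate0 ndB) => z.
have xu0 : B x u = 0 by rewrite xu // memv_line.
have : B x (z - B z u *: u) = 0.
  apply: xW; apply/mem_orthovP => _ /vlineP[k ->].
  by rewrite !sformE uu; ring.
by rewrite !sformE xu0; lra.
Qed.

(** After u is sent to u', the images of v and v' have the same component along
    u', so their components orthogonal to u' have equal squares; these are
    nonzero since the vectors are not opposite or equal to u'. *)
Lemma isometry_unit_pair u v u' v' : nondegenerate B ->
  B u u = 1 -> B v v = 1 -> B u' u' = 1 -> B v' v' = 1 ->
  v <> u -> v <> - u -> v' <> u' -> v' <> - u' -> B u v = B u' v' ->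
  exists f : 'End(V), [/\ isometry B B f, f u = u' & f v = v'].
Proof.
move=> ndB uu vv uu' vv' vu vnu vu' vnu' uv.
have unit_neq0 x : B x x = 1 -> x != 0.
  by apply: contra_eq_neq => ->; rewrite linear0l eq_sym oner_neq0.
have [||||||f [fB fu _]] := @witt_vector fullv u u'; rewrite ?memvf ?unit_neq0 //.
- by rewrite capfv; apply/eqP.
- by rewrite uu uu'.
pose c := B u v; pose a := f v - c *: u'; pose b := v' - c *: u'.
have orth w : B u' w = c -> w - c *: u' \in orthov B <[u']>.
  move=> wc; apply/mem_orthovP => _ /vlineP[k ->].
  by rewrite !sformE (sformC w) wc uu'; ring.
(* A unit vector proportional to u' is u' or its opposite. *)
have neq0 w : B w w = 1 -> w <> u' -> w <> - u' -> w - c *: u' != 0.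
  move=> ww wu wnu; rewrite subr_eq0; apply/eqP => wE.
  move: ww; rewrite wE !sformE uu' => /eqP; rewrite mulr1 -expr2 sqrf_eq1.
  by case/orP => /eqP cE; [apply: wu|apply: wnu];
     rewrite wE cE ?scale1r ?scaleN1r.
have finj : injective f by apply/lker0P/eqP/isometry_ker.
have fuv : B u' (f v) = c by rewrite -fu fB.
have [|||||h [hB ha hfix]] :=
  @witt_vector (orthov B <[u']>) a b (orthov_unit_nondegenerate ndB uu').
- exact: orth.
- by apply: orth; rewrite -uv.
- apply: neq0; first by rewrite fB.
  + by rewrite -fu => /finj.
  + by rewrite -fu -linearN => /finj.
- exact: neq0.
- rewrite /a /b !sformE uu' (sformC (f v)) (sformC v') fuv -uv fB vv vv' -/c.
  by ring.
have hu : h u' = u'.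
  apply: hfix; apply/mem_orthovP => w /mem_orthovP wu.
  by rewrite sformC wu // memv_line.
exists (h \o f)%VF; split.
- exact: isometry_comp.
- by rewrite comp_lfunE fu hu.
- have -> : v' = b + c *: u' by rewrite subrK.
  by rewrite comp_lfunE -ha -{1}hu -linearZ -linearD subrK.
Qed.

(** * The null cone of a form of index one *)

Lemma exists_timelike : has_index B 1 -> exists t, B t t < 0.
Proof.
move=> [[U [dimU negU]] _]; exists (vpick U); apply: negU; first exact: memv_pick.
by rewrite vpick0 -dimv_eq0 dimU.
Qed.

Section Timelike.
Variable t : V.
Hypotheses (ndB : nondegenerate B) (indB : has_index B 1) (tt : B t t < 0).

Lemma timelike_orth_ge0 x : B x t = 0 -> 0 <= B x x.
Proof.
move=> xt; rewrite leNgt; apply/negP => xx.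
have [_ /(_ (<[t]> + <[x]>)%VS)] := indB.
have -> : \dim (<[t]> + <[x]>) = 2%N.
  rewrite dimv_disjoint_sum; last first.
    apply/eqP; rewrite -subv0; apply/subvP => _ /memv_capP[/vlineP[k ->]].
    move=> /vlineP[l kl]; rewrite memv0.
    have : B (k *: t) t = 0 by rewrite kl sformE xt mulr0.
    rewrite sformE => /eqP; rewrite mulf_eq0 (lt_eqF tt) orbF => /eqP ->.
    by rewrite scale0r.
  have nz y : B y y < 0 -> y != 0.
    by apply: contraTneq => ->; rewrite linear0l ltxx.
  by rewrite !dim_vline !nz.
suff neg : negative_definite_on B (<[t]> + <[x]>) by move=> /(_ neg).
move=> _ /memv_addP[_ /vlineP[k ->] [_ /vlineP[l ->] ->]] nz.
rewrite !sformE (sformC t) xt.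
have [k0|k0] := eqVneq k 0; last first.
  have : 0 < k ^+ 2 * - B t t by rewrite mulr_gt0 ?oppr_gt0 ?exprn_even_gt0.
  have : 0 <= l ^+ 2 * - B x x by rewrite mulr_ge0 ?sqr_ge0 // oppr_ge0 ltW.
  lra.
have [l0|l0] := eqVneq l 0; first by rewrite k0 l0 !scale0r addr0 eqxx in nz.
have : 0 < l ^+ 2 * - B x x by rewrite mulr_gt0 ?oppr_gt0 ?exprn_even_gt0.
rewrite k0; lra.
Qed.

(** A nonzero null x in t^⊥ would pair nontrivially with some z in t^⊥, and then
    B (s x + z) (s x + z), being affine and nonconstant in s, would take the
    value -1 in t^⊥. *)
Lemma timelike_orth_gt0 x : B x t = 0 -> x != 0 -> 0 < B x x.
Proof.
move=> xt x0; rewrite lt_def timelike_orth_ge0 // andbT; apply/eqP => xx.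
have tt0 : B t t != 0 by rewrite lt_eqF.
have [z zt xz] : exists2 z, B z t = 0 & B x z != 0.
  have [z xz] := nondegenerateP ndB x0.
  exists (z - (B z t / B t t) *: t); first by rewrite !sformE; field.
  by rewrite !sformE xt mulr0 subr0.
pose s := (-1 - B z z) / (2 * B x z).
have : 0 <= B (s *: x + z) (s *: x + z).
  by apply: timelike_orth_ge0; rewrite !sformE xt zt; ring.
rewrite !sformE (sformC z x) xx.
suff -> : s * (s * 0) + s * B x z + (s * B x z + B z z) = -1 by lra.
by rewrite /s; field.
Qed.

(** The null vectors of the Lorentzian plane spanned by t and x.  Being given in
    conjugate pairs, they separate the even and odd parts in x of any quadratic
    condition that holds on the null cone. *)
Lemma null_combination x : B x t = 0 -> x != 0 ->
  exists s, [/\ s != 0, B (s *: t + x) (s *: t + x) = 0 &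
                B (s *: t - x) (s *: t - x) = 0].
Proof.
move=> xt x0; have q0 := timelike_orth_gt0 xt x0.
have tt0 : B t t != 0 by rewrite lt_eqF.
have q : 0 < B x x / - B t t by rewrite divr_gt0 // oppr_gt0.
pose s := Num.sqrt (B x x / - B t t).
have sE : s * s * B t t = - B x x.
  by rewrite -expr2 sqr_sqrtr ?ltW //; field.
exists s; rewrite gt_eqF ?sqrtr_gt0 // !sformE (sformC t) xt; split=> //; nra.
Qed.

End Timelike.

(** For x in t^⊥, adding and subtracting the conditions on f (s t + x) and
    f (s t - x) shows that f t and f x are orthogonal and that B (f x) (f x) is
    B x x times the factor found at t.  Decomposing along t gives the quadratic
    form on V, and polarization the bilinear one. *)
Lemma null_preserving_conformal f : nondegenerate B -> has_index B 1 ->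
  (forall x, B x x = 0 -> B (f x) (f x) = 0) ->
  exists l, forall x y, B (f x) (f y) = l * B x y.
Proof.
move=> ndB indB fnull; have [t tt] := exists_timelike indB.
have tt0 : B t t != 0 by rewrite lt_eqF.
pose l := B (f t) (f t) / B t t.
have ftt : B (f t) (f t) = l * B t t by rewrite divfK.
have orthE x : B x t = 0 -> B (f t) (f x) = 0 /\ B (f x) (f x) = l * B x x.
  move=> xt; have [->|x0] := eqVneq x 0.
    by rewrite linear0 !linear0r mulr0.
  have [s [s0 np nm]] := null_combination ndB indB tt xt x0.
  move: (fnull _ np) (fnull _ nm) (np).
  rewrite !(linearD, linearN, linearZ) /= !sformE (sformC (f x) (f t)) (sformC t) xt.
  move=> fp fm np0.
  have : s * B (f t) (f x) = 0 by lra.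
  move/eqP; rewrite mulf_eq0 (negPf s0) /= => /eqP ftx; split=> //.
  rewrite ftx ftt in fp; have -> : B x x = - (s * (s * B t t)) by lra.
  by lra.
have quad x : B (f x) (f x) = l * B x x.
  have [k [y [xE yt]]] : exists k y, x = k *: t + y /\ B y t = 0.
    exists (B x t / B t t), (x - (B x t / B t t) *: t).
    by rewrite addrC subrK !sformE; split=> //; field.
  have [fty fyy] := orthE _ yt; rewrite xE.
  rewrite !(linearD, linearZ) /= !sformE (sformC (f y) (f t)) (sformC t).
  rewrite fty fyy yt ftt.
  by ring.
exists l => x y; move: (quad (x + y)); rewrite linearD !sformE !quad.
rewrite (sformC (f y)) (sformC y); lra.
Qed.

(** The null vectors orthogonal to u span u^⊥, so w is orthogonal to u^⊥.
    Dimension at least three is essential: u^⊥ must contain, besides a timelike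
    t, a nonzero x orthogonal to t, since a timelike line has no nonzero null
    vectors. *)
Lemma null_orth_sub u w : nondegenerate B -> has_index B 1 ->
  (2 < \dim {:V})%N -> B u u = 1 ->
  (forall y, B y y = 0 -> B y u = 0 -> B y w = 0) -> w = B w u *: u.
Proof.
move=> ndB indB dimV uu nullw; have [t0 tt0] := exists_timelike indB.
have [t tu tt] : exists2 t, B t u = 0 & B t t < 0.
  exists (t0 - B t0 u *: u); rewrite !sformE ?(sformC u) uu; first ring.
  by have := sqr_ge0 (B t0 u); rewrite expr2; lra.
have ttn0 : B t t != 0 by rewrite lt_eqF.
have pairE x : B x t = 0 -> B x u = 0 -> x != 0 -> B x w = 0 /\ B t w = 0.
  move=> xt xu x0; have [s [s0 np nm]] := null_combination ndB indB tt xt x0.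
  have : B (s *: t + x) w = 0 by apply: nullw => //; rewrite !sformE tu xu; ring.
  have : B (s *: t - x) w = 0 by apply: nullw => //; rewrite !sformE tu xu; ring.
  rewrite !sformE => em ep; split; first lra.
  have : s * B t w = 0 by lra.
  by move/eqP; rewrite mulf_eq0 (negPf s0) /= => /eqP.
(* Projection onto the complement of the orthogonal pair t, u. *)
pose pr z := z - B z u *: u - (B z t / B t t) *: t.
have prt z : B (pr z) t = 0.
  by rewrite /pr !sformE (sformC u) tu; field.
have pru z : B (pr z) u = 0 by rewrite /pr !sformE tu uu; ring.
have prE z : z = pr z + (B z t / B t t) *: t + B z u *: u by rewrite /pr !subrK.
have tw : B t w = 0.
  suff [x px] : exists x, pr x != 0 by have [] := pairE _ (prt x) (pru x) px.
  apply: contrapT => /forallNP pr0.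
  suff : (fullv <= <[t]> + <[u]>)%VS.
    move=> /dimvS; have := dimv_add_leqif <[t]>%VS <[u]>%VS; rewrite !dim_vline.
    case=> le2 _ le1; move: (leq_trans dimV (leq_trans le1 le2)).
    by case: (t != 0); case: (u != 0).
  apply/subvP => z _; rewrite (prE z).
  have -> : pr z = 0 by apply/eqP/negPn/negP/pr0.
  by rewrite add0r memv_add // memvZ // memv_line.
apply/eqP; rewrite -subr_eq0; apply/eqP/(nondegenerate0 ndB) => z.
have prw : B (pr z) w = 0.
  by have [->|/(pairE _ (prt z) (pru z))[]//] := eqVneq (pr z) 0; rewrite linear0l.
rewrite (prE z); move: (pr z) prw (pru z) => y yw yu.
by rewrite sformC !sformE yw tw yu tu uu (sformC w u); ring.
Qed.

End SymmetricForms.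

(** * Action on hyperspheres *)

Section Projective.
Context {R : realType} {V : vectType R} (B : {symmetric V}).
Implicit Types (u v w x y : V) (f : 'End(V)) (g : proj V -> proj V).

Lemma exists_line x : x != 0 -> exists p : proj V, val p = <[x]>%VS.
Proof.
move=> x0; have dx : \dim <[x]> == 1%N by rewrite dim_vline x0.
by exists (exist _ <[x]>%VS dx).
Qed.

Lemma exists_induced_map f : lker f = 0%VS ->
  exists g, forall p, val (g p) = (f @: val p)%VS.
Proof.
move=> f0.
have df (p : proj V) : \dim (f @: val p) == 1%N.
  by rewrite limg_dim_eq ?f0 ?capv0 //; exact: (valP p).
by exists (fun p => exist _ (f @: val p)%VS (df p)).
Qed.

(** Lets statements about images of hyperspheres cover the whole Moebius space
    as well. *)
Lemma moebius_space_hypersphere0 : moebius_space B = hypersphere B 0.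
Proof.
apply/seteqP; split=> p [x].
  by case=> x0 xx px; exists x; rewrite linear0r.
by case=> x0 xx _ px; exists x.
Qed.

Lemma hypersphereN w : hypersphere B (- w) = hypersphere B w.
Proof.
by apply/seteqP; split=> p [x [x0 xx xw px]]; exists x; split=> //;
  move: xw; rewrite sformNr; lra.
Qed.

Lemma hypersphere_mem w p x :
  hypersphere B w p -> val p = <[x]>%VS -> B x x = 0 /\ B x w = 0.
Proof.
move=> [y [_ yy yw ->]] yx.
have : x \in <[y]>%VS by rewrite yx memv_line.
by case/vlineP => k ->; rewrite !sformE yy yw !mulr0.
Qed.

Lemma isometry_image_hypersphere f g w : lker f = 0%VS -> isometry B B f ->
  (forall p, val (g p) = (f @: val p)%VS) ->
  g @` hypersphere B w = hypersphere B (f w).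
Proof.
move=> f0 fB gf; have ker0 : lker f == 0%VS by apply/eqP.
apply/seteqP; split=> [_ [p [x [x0 xx xw px]] <-]|p [y [y0 yy yw py]]].
  exists (f x); rewrite !fB; split=> //; last by rewrite gf px limg_line.
  by rewrite -(linear0 f) (inj_eq (lker0P ker0)).
have fK := lker0_lfunVK ker0; pose x := (f^-1)%VF y.
have fx : f x = y by exact: fK.
have x0 : x != 0 by apply: contra_neq y0 => x0; rewrite -fx x0 linear0.
have [q qx] := exists_line x0.
exists q; first by exists x; split=> //; rewrite -fB fx.
by apply: val_inj; rewrite gf qx limg_line fx.
Qed.

Lemma isometry_moebius f g : lker f = 0%VS -> isometry B B f ->
  (forall p, val (g p) = (f @: val p)%VS) -> moebius_group B g.
Proof.
move=> f0 fB gf; split; first by exists f.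
rewrite moebius_space_hypersphere0.
by rewrite (isometry_image_hypersphere _ f0 fB gf) linear0.
Qed.

Lemma moebius_conformal f g : nondegenerate B -> has_index B 1 ->
  lker f = 0%VS -> (forall p, val (g p) = (f @: val p)%VS) ->
  g @` moebius_space B = moebius_space B ->
  exists2 l, l != 0 & forall x y, B (f x) (f y) = l * B x y.
Proof.
move=> ndB indB f0 gf; rewrite moebius_space_hypersphere0 => gS.
have [|l fl] := null_preserving_conformal (f := f) ndB indB.
  move=> x xx; have [->|x0] := eqVneq x 0; first by rewrite linear0 linear0l.
  have [p px] := exists_line x0.
  have gp : hypersphere B 0 (g p).
    by rewrite -gS; exists p => //; exists x; rewrite linear0r.
  have gpx : val (g p) = <[f x]>%VS by rewrite gf px limg_line.
  by have [] := hypersphere_mem gp gpx.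
(* A zero factor would put the image of f, which is V, into the radical. *)
exists l => //; apply/eqP => l0.
have [t tt] := exists_timelike indB.
have ker0 : lker f == 0%VS by apply/eqP.
have /eqP : t = 0.
  apply: (nondegenerate0 ndB) => z.
  by rewrite -(lker0_lfunVK ker0 t) -(lker0_lfunVK ker0 z) fl l0 mul0r.
by apply/negP; apply: contraTneq tt => ->; rewrite linear0l ltxx.
Qed.

(** The null vectors orthogonal to w are multiples of images f x with x null
    and orthogonal to u, hence orthogonal to f u by conformality.  Arguing from
    the image side avoids having to know the sign of B (f u) (f u). *)
Lemma hypersphere_image_normal f g l u w : nondegenerate B -> has_index B 1 ->
  (2 < \dim {:V})%N -> (forall p, val (g p) = (f @: val p)%VS) ->
  (forall x y, B (f x) (f y) = l * B x y) -> B w w = 1 ->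
  g @` hypersphere B u = hypersphere B w -> f u = B (f u) w *: w.
Proof.
move=> ndB indB dimV gf fl ww gS; apply: null_orth_sub => // y yy yw.
have [->|y0] := eqVneq y 0; first by rewrite linear0l.
have [q qy] := exists_line y0.
have : hypersphere B w q by exists y.
rewrite -gS => -[p [x [x0 xx xu px]] gpq].
have : y \in <[f x]>%VS by rewrite -limg_line -px -gf gpq qy memv_line.
by case/vlineP => k ->; rewrite sformE fl xu !mulr0.
Qed.

End Projective.

Theorem proposition2 (R : realType) (n : nat) (V : vectType R)
    (B : {symmetric V}) (N M N' M' : set (proj V)) (u v u' v' : V) :
  (1 <= n)%N ->
  \dim {:V} = n.+2 -> nondegenerate B -> has_index B 1 ->
  unit_vectors B u -> unit_vectors B v ->
  unit_vectors B u' -> unit_vectors B v' ->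
  N = hypersphere B u -> M = hypersphere B v ->
  N' = hypersphere B u' -> M' = hypersphere B v' ->
  N <> M -> N' <> M' ->
  (exists g : proj V -> proj V,
     [/\ moebius_group B g, g @` N = N' & g @` M = M'])
  <-> `|B u v| = `|B u' v'|.
Proof.
move=> n1 dimV ndB indB uu vv uu' vv' -> -> -> -> NM NM'.
have dim3 : (2 < \dim {:V})%N by rewrite dimV.
split=> [[g [[[f [f0 gf]] gS] gu gv]]|uv].
  have [l l0 fl] := moebius_conformal ndB indB f0 gf gS.
  have fu := hypersphere_image_normal ndB indB dim3 gf fl uu' gu.
  have fv := hypersphere_image_normal ndB indB dim3 gf fl vv' gv.
  set m := B (f u) u' in fu; set k := B (f v) v' in fv.
  have lm : l = m * m by have := fl u u; rewrite fu !sformE uu uu'; lra.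
  have lk : l = k * k by have := fl v v; rewrite fv !sformE vv vv'; lra.
  have luv : l * B u v = m * (k * B u' v') by rewrite -fl fu fv !sformE.
  have mk : `|m| = `|k|.
    by apply/eqP; rewrite eqr_norm2 -eqf_sqr !expr2 -lm lk.
  have nl0 : `|l| != 0 by rewrite normr_eq0.
  apply: (mulfI nl0); rewrite -normrM luv !normrM lm normrM mk; ring.
wlog {uv} uv : v' vv' NM' / B u v = B u' v'.
  move=> H; have /eqP := uv; rewrite eqr_norm2 => /orP[/eqP|/eqP] uvE.
    exact: H.
  rewrite -(hypersphereN B v'); apply: H; rewrite ?hypersphereN //.
    by rewrite /unit_vectors /= sformNl sformNr opprK.
  by rewrite sformNr.
have neq x y : hypersphere B x <> hypersphere B y -> y <> x /\ y <> - x.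
  by move=> xy; split=> yx; apply: xy; rewrite yx ?hypersphereN.
have [vu vnu] := neq _ _ NM; have [vu' vnu'] := neq _ _ NM'.
have [f [fB fu fv]] := isometry_unit_pair ndB uu vv uu' vv' vu vnu vu' vnu' uv.
have f0 := isometry_ker ndB fB.
have [g gf] := exists_induced_map f0.
exists g; split; first exact: isometry_moebius gf.
- by rewrite (isometry_image_hypersphere _ f0 fB gf) fu.
- by rewrite (isometry_image_hypersphere _ f0 fB gf) fv.
Qed.
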